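(* Let $F\in\mathbb{R}$. Consider the regulator's problem restricted to two-part tariffs $T(q)=A+\pi^\top q$ with $A\in\mathbb{R}$, $\pi\in\mathbb{R}^N$: $$\max_{A,\pi}\ \overline{\mathsf{cs}}(T)\quad\text{s.t.}\quad \overline{\mathsf{rs}}(T)=F .$$ The two-part tariff $T^*(q)=A^*+\pi^{*\top}q$ that solves this problem is characterized by $$\pi^*=\overline{\lambda}+\mathbb{E}[\nabla_\pi D(\pi^*,\omega)]^{-1}\,\mathbb{E}[\nabla_\pi D(\pi^*,\omega)(\lambda-\overline{\lambda})],\qquad A^*=\frac{1}{M}\left(F-\overline{\phi}(\pi^* )\right).$$
   Context: Model. Fix integers $N,M\ge 1$. $\lambda$ is a random vector in $\mathbb{R}_+^N$ (wholesale prices) and, for $i=1,\dots,M$, $\omega^i=(\omega^i_1,\dots,\omega^i_N)$ is a random vector in $\mathbb{R}^N$ (local state of customer $i$); $\omega=(\omega^1,\dots,\omega^M)$; the joint law of $(\lambda,\omega)$ is arbitrary. An overline denotes expectation, e.g. $\overline{\lambda}=\mathbb{E}[\lambda]$. Customer $i$ has a gross surplus function $S^i:\mathbb{R}^N\times\mathbb{R}^N\to\mathbb{R}$, $(q^i,\omega^i)\mapsto S^i(q^i,\omega^i)$, continuously differentiable. A (ex-ante) tariff is a deterministic function $T:\mathbb{R}^N\to\mathbb{R}$. A causal policy is a map $\omega^i\mapsto q^i(\omega^i)\in\mathbb{R}^N$ whose $k$-th component depends only on $(\omega^i_1,\dots,\omega^i_k)$. Given $T$, customer $i$'s consumption $q^i(T,\omega^i)$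 is a causal policy maximizing $\mathbb{E}[S^i(q^i(\omega^i),\omega^i)-T(q^i(\omega^i))]$. (Every customer pays the charge $T$; no customer opts out.) Define the expected consumer and retailer surplus $$\overline{\mathsf{cs}}(T)=\mathbb{E}\Big[\sum_{i=1}^M S^i(q^i(T,\omega^i),\omega^i)-T(q^i(T,\omega^i))\Big],\quad \overline{\mathsf{rs}}(T)=\mathbb{E}\Big[\sum_{i=1}^M T(q^i(T,\omega^i))-\lambda^\top q^i(T,\omega^i)\Big].$$ Demand. For affine tariffs $T(q)=A+\pi^\top q$ it is assumed that $q^i(T,\omega^i)$ depends on $T$ only through $\pi$, and one writes $D^i(\pi,\omega^i)=q^i(T,\omega^i)$. It is assumed that $D^i$ is componentwise nonnegative, continuously differentiable in $\pi$, and that $\nabla_\pi D^i$ is negative definite ($x^\top(\nabla_\pi D^i)x<0$ for all $x\ne0$; symmetry is not required). $D(\pi,\omega)=\sum_{i=1}^M D^i(\pi,\omega^i)$. Convention: in products with vectors, the $N\times N$ matrix $\nabla_\pi D$ has $(k,t)$ entry $\partial D_t/\partial\pi_k$. All expectations are assumed finite and differentiation may be exchanged with expectation. Define $\overline{\phi}(\pi)=\mathbb{E}[(\pi-\lambda)^\top D(\pi,\omega)]$, so that $\overline{\mathsf{rs}}(T)=\overline{\phi}(\pi)+MA$ for $T(q)=A+\pi^\top q$. Standing assumption (Assumption 1): $g(\pi)=\mathbb{E}[\nabla_\pi D(\pi,\omega)(\pi-\lambda)]$ has a negative definite Jacobian matrix $\nabla g(\pi)$ for all $\pi$. *)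

(* Defs.v *)
(* Library: MathComp and MathComp-Analysis. *)
From HB Require Import structures.
From mathcomp Require Import all_boot all_order all_algebra.
From mathcomp Require Import all_classical all_reals all_analysis.

Set Implicit Arguments.
Unset Strict Implicit.
Unset Printing Implicit Defensive.

Import Order.TTheory GRing.Theory Num.Theory.
Import numFieldNormedType.Exports.

Local Open Scope classical_set_scope.
Local Open Scope ring_scope.

Definition dot (R : realType) (N : nat) (x y : 'rV[R]_N) : R :=
  \sum_(k < N) x 0 k * y 0 k.

(* Vectors are rows, but matrices act on them as on columns: the k-th entry is
   \sum_t A k t * x_t. *)
Definition mulmv (R : realType) (N : nat) (A : 'M[R]_N) (x : 'rV[R]_N) :
    'rV[R]_N :=
  (A *m x^T)^T.

(* Symmetry of A is not required. *)
Definition negative_definite (R : realType) (N : nat) (A : 'M[R]_N) : Prop :=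
  forall x : 'rV[R]_N, x != 0 -> dot x (mulmv A x) < 0.

Definition nonnegative_vec (R : realType) (N : nat) (x : 'rV[R]_N) : Prop :=
  forall k, 0 <= x 0 k.

(* On finite-dimensional V and open U this is class C^1: continuity of every
   directional derivative is continuity of the differential. *)
Definition continuously_differentiable_on (R : realType)
    (V W : normedModType R) (U : set V) (f : V -> W) : Prop :=
  forall x, U x ->
    differentiable f x /\ forall v : V, {for x, continuous ('D_v f)}.

Definition borel_vec (R : realType) (N : nat) :=
  g_sigma_algebraType (@open 'rV[R]_N).

Definition random_vector (R : realType) (d : measure_display)
    (Omega : measurableType d) (N : nat) (X : Omega -> 'rV[R]_N) : Prop :=
  measurable_fun setT (X : Omega -> borel_vec R N).

(* fine sends an infinite expectation to 0; integrability is always required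
   separately. *)
Definition mean (R : realType) (d : measure_display)
    (Omega : measurableType d) (P : probability Omega R) (X : Omega -> R) : R :=
  fine ('E_P[X])%E.

Definition finite_mean (R : realType) (d : measure_display)
    (Omega : measurableType d) (P : probability Omega R) (X : Omega -> R) :
    Prop :=
  P.-integrable setT (EFin \o X).

Definition mean_mx (R : realType) (d : measure_display)
    (Omega : measurableType d) (P : probability Omega R) (m n : nat)
    (X : Omega -> 'M[R]_(m, n)) : 'M[R]_(m, n) :=
  \matrix_(i, j) mean P (fun s => X s i j).

Definition finite_mean_mx (R : realType) (d : measure_display)
    (Omega : measurableType d) (P : probability Omega R) (m n : nat)
    (X : Omega -> 'M[R]_(m, n)) : Prop :=
  forall i j, finite_mean P (fun s => X s i j).

Definition derivative_exchanges_with_mean (R : realType) (d : measure_display)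
    (Omega : measurableType d) (P : probability Omega R) (N : nat)
    (f : 'rV[R]_N -> Omega -> R) (pi : 'rV[R]_N) : Prop :=
  forall v : 'rV[R]_N,
    [/\ derivable (fun p => mean P (f p)) pi v,
        finite_mean P (fun s => 'D_v (fun p => f p s) pi) &
        'D_v (fun p => mean P (f p)) pi
          = mean P (fun s => 'D_v (fun p => f p s) pi)].

Definition causal_policy (R : realType) (N : nat)
    (q : 'rV[R]_N -> 'rV[R]_N) : Prop :=
  measurable_fun setT (q : borel_vec R N -> borel_vec R N) /\
  forall (k : 'I_N) (w w' : 'rV[R]_N),
    (forall j : 'I_N, (j <= k)%N -> w 0 j = w' 0 j) -> q w 0 k = q w' 0 k.

Definition net_surplus (R : realType) (N : nat)
    (S : 'rV[R]_N -> 'rV[R]_N -> R) (T : 'rV[R]_N -> R)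
    (q : 'rV[R]_N -> 'rV[R]_N) (w : 'rV[R]_N) : R :=
  S (q w) w - T (q w).

Definition optimal_policy (R : realType) (d : measure_display)
    (Omega : measurableType d) (P : probability Omega R) (N : nat)
    (S : 'rV[R]_N -> 'rV[R]_N -> R) (om : Omega -> 'rV[R]_N)
    (T : 'rV[R]_N -> R) (q : 'rV[R]_N -> 'rV[R]_N) : Prop :=
  [/\ causal_policy q,
      finite_mean P (fun s => net_surplus S T q (om s)) &
      forall q' : 'rV[R]_N -> 'rV[R]_N,
        causal_policy q' ->
        finite_mean P (fun s => net_surplus S T q' (om s)) ->
        mean P (fun s => net_surplus S T q' (om s))
          <= mean P (fun s => net_surplus S T q (om s))].

Definition two_part (R : realType) (N : nat) (A : R) (pi : 'rV[R]_N)
    (x : 'rV[R]_N) : R :=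
  A + dot pi x.

(* In cs and rs, q i T w is the consumption of customer i under the tariff T
   in the local state w. *)
Definition cs (R : realType) (d : measure_display)
    (Omega : measurableType d) (P : probability Omega R) (N M : nat)
    (omega : 'I_M -> Omega -> 'rV[R]_N)
    (S : 'I_M -> 'rV[R]_N -> 'rV[R]_N -> R)
    (q : 'I_M -> ('rV[R]_N -> R) -> 'rV[R]_N -> 'rV[R]_N)
    (T : 'rV[R]_N -> R) : R :=
  mean P (fun s => \sum_(i < M)
    (S i (q i T (omega i s)) (omega i s) - T (q i T (omega i s)))).

Definition rs (R : realType) (d : measure_display)
    (Omega : measurableType d) (P : probability Omega R) (N M : nat)
    (lambda : Omega -> 'rV[R]_N) (omega : 'I_M -> Omega -> 'rV[R]_N)
    (q : 'I_M -> ('rV[R]_N -> R) -> 'rV[R]_N -> 'rV[R]_N)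
    (T : 'rV[R]_N -> R) : R :=
  mean P (fun s => \sum_(i < M)
    (T (q i T (omega i s)) - dot (lambda s) (q i T (omega i s)))).

Definition total_demand (R : realType) (d : measure_display)
    (Omega : measurableType d) (N M : nat)
    (omega : 'I_M -> Omega -> 'rV[R]_N)
    (D : 'I_M -> 'rV[R]_N -> 'rV[R]_N -> 'rV[R]_N)
    (pi : 'rV[R]_N) (s : Omega) : 'rV[R]_N :=
  \sum_(i < M) D i pi (omega i s).

(* jacobian acts on row vectors from the right, so its (k, t) entry is the
   derivative of the t-th component of demand in the k-th price. *)
Definition grad_demand (R : realType) (d : measure_display)
    (Omega : measurableType d) (N M : nat)
    (omega : 'I_M -> Omega -> 'rV[R]_N)
    (D : 'I_M -> 'rV[R]_N -> 'rV[R]_N -> 'rV[R]_N)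
    (pi : 'rV[R]_N) (s : Omega) : 'M[R]_N :=
  jacobian (fun p => total_demand omega D p s) pi.

Definition phi (R : realType) (d : measure_display)
    (Omega : measurableType d) (P : probability Omega R) (N M : nat)
    (lambda : Omega -> 'rV[R]_N) (omega : 'I_M -> Omega -> 'rV[R]_N)
    (D : 'I_M -> 'rV[R]_N -> 'rV[R]_N -> 'rV[R]_N) (pi : 'rV[R]_N) : R :=
  mean P (fun s => dot (pi - lambda s) (total_demand omega D pi s)).

Definition g (R : realType) (d : measure_display)
    (Omega : measurableType d) (P : probability Omega R) (N M : nat)
    (lambda : Omega -> 'rV[R]_N) (omega : 'I_M -> Omega -> 'rV[R]_N)
    (D : 'I_M -> 'rV[R]_N -> 'rV[R]_N -> 'rV[R]_N) (pi : 'rV[R]_N) :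
    'rV[R]_N :=
  mean_mx P (fun s => mulmv (grad_demand omega D pi s) (pi - lambda s)).

(* (A, pi) maximizes expected consumer surplus among the two-part tariffs with
   price in Prices that yield expected retailer surplus F. *)
Definition regulator_solution (R : realType) (d : measure_display)
    (Omega : measurableType d) (P : probability Omega R) (N M : nat)
    (lambda : Omega -> 'rV[R]_N) (omega : 'I_M -> Omega -> 'rV[R]_N)
    (S : 'I_M -> 'rV[R]_N -> 'rV[R]_N -> R)
    (q : 'I_M -> ('rV[R]_N -> R) -> 'rV[R]_N -> 'rV[R]_N)
    (Prices : set 'rV[R]_N) (F A : R) (pi : 'rV[R]_N) : Prop :=
  [/\ Prices pi,
      rs P lambda omega q (two_part A pi) = F &
      forall (A' : R) (pi' : 'rV[R]_N), Prices pi' ->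
        rs P lambda omega q (two_part A' pi') = F ->
        cs P omega S q (two_part A' pi') <= cs P omega S q (two_part A pi)].

(* Main.v *)
(* Substituting the budget constraint, the regulator maximizes the total surplus
   W(pi) = \sum_i U_i(pi) + phi(pi), where U_i is the indirect surplus of
   customer i. Optimality of the policies gives the envelope formula
   grad U_i = - E[D_i], and grad phi = E[D] + g, so that grad W = g. Since g has
   a negative definite Jacobian it is strictly decreasing along segments: an
   interior price maximizes W if and only if it is a zero of g, and there is at
   most one such price. Solving g(pi) = 0 for pi yields the stated formula;
   E[grad D] is invertible because it is negative definite. *)
Require Import Defs.
From HB Require Import structures.
From mathcomp Require Import all_boot all_order all_algebra.
From mathcomp Require Import all_classical all_reals all_analysis.

Import Order.TTheory GRing.Theory Num.Theory.
Import numFieldNormedType.Exports.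

Local Open Scope classical_set_scope.
Local Open Scope ring_scope.

Set Implicit Arguments.
Unset Strict Implicit.
Unset Printing Implicit Defensive.

(** * Algebra of the dot product and of matrices acting on row vectors *)

Lemma dotE (R : realType) (N : nat) (x y : 'rV[R]_N) :
  dot x y = (x *m y^T) 0 0.
Proof. by rewrite mxE; apply: eq_bigr => k _; rewrite !mxE. Qed.

Lemma dotC (R : realType) (N : nat) (x y : 'rV[R]_N) : dot x y = dot y x.
Proof. by apply: eq_bigr => k _; rewrite mulrC. Qed.

Lemma dotDl (R : realType) (N : nat) (x y z : 'rV[R]_N) :
  dot (x + y) z = dot x z + dot y z.
Proof. by rewrite !dotE mulmxDl mxE. Qed.

Lemma dotDr (R : realType) (N : nat) (x y z : 'rV[R]_N) :
  dot x (y + z) = dot x y + dot x z.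
Proof. by rewrite dotC dotDl !(dotC x). Qed.

Lemma dotZl (R : realType) (N : nat) (a : R) (x y : 'rV[R]_N) :
  dot (a *: x) y = a * dot x y.
Proof. by rewrite !dotE -scalemxAl mxE. Qed.

Lemma dotNl (R : realType) (N : nat) (x y : 'rV[R]_N) : dot (- x) y = - dot x y.
Proof. by rewrite -scaleN1r dotZl mulN1r. Qed.

Lemma dotBl (R : realType) (N : nat) (x y z : 'rV[R]_N) :
  dot (x - y) z = dot x z - dot y z.
Proof. by rewrite dotDl dotNl. Qed.

Lemma dotBr (R : realType) (N : nat) (x y z : 'rV[R]_N) :
  dot x (y - z) = dot x y - dot x z.
Proof. by rewrite dotC dotBl !(dotC x). Qed.

Lemma dot0r (R : realType) (N : nat) (x : 'rV[R]_N) : dot x 0 = 0.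
Proof. by rewrite -(subrr x) dotBr subrr. Qed.

Lemma dot_sumr (R : realType) (N : nat) (I : Type) (r : seq I)
    (x : 'rV[R]_N) (y : I -> 'rV[R]_N) :
  dot x (\sum_(i <- r) y i) = \sum_(i <- r) dot x (y i).
Proof.
elim: r => [|i r IH]; first by rewrite !big_nil dot0r.
by rewrite !big_cons dotDr IH.
Qed.

(** Passes between the column action of [mulmv] and the row action [x *m A] through which [jacobian]
    computes directional derivatives. *)
Lemma dot_mulmv (R : realType) (N : nat) (A : 'M[R]_N) (x y : 'rV[R]_N) :
  dot x (mulmv A y) = dot (x *m A) y.
Proof. by rewrite !dotE /mulmv trmxK mulmxA. Qed.

Lemma dot_deltal (R : realType) (N : nat) (k : 'I_N) (x : 'rV[R]_N) :
  dot (delta_mx 0 k) x = x 0 k.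
Proof. by rewrite dotE -rowE !mxE. Qed.

Lemma dot_eq0 (R : realType) (N : nat) (x : 'rV[R]_N) :
  (forall v, dot v x = 0) -> x = 0.
Proof.
by move=> x0; apply/rowP => k; rewrite mxE -(x0 (delta_mx 0 k)) dot_deltal.
Qed.

Lemma mulmvB (R : realType) (N : nat) (A : 'M[R]_N) (x y : 'rV[R]_N) :
  mulmv A (x - y) = mulmv A x - mulmv A y.
Proof. by rewrite /mulmv linearB /= mulmxBr linearB. Qed.

(** A row [x] of the left kernel satisfies [x *m A = 0], so the quadratic form vanishes at [x],
    which negative definiteness allows only for [x = 0]. *)
Lemma negative_definite_unitmx (R : realType) (N : nat) (A : 'M[R]_N) :
  negative_definite A -> A \in unitmx.
Proof.
move=> Aneg; rewrite -row_free_unit -kermx_eq0; apply/eqP/row_matrixP => i.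
rewrite row0; apply: contrapT => /eqP /Aneg.
have -> : dot (row i (kermx A)) (mulmv A (row i (kermx A))) = 0.
  by rewrite dot_mulmv -row_mul mulmx_ker row0 dotC; exact: dot0r.
by rewrite ltxx.
Qed.

Lemma mulmv_eq (R : realType) (N : nat) (A : 'M[R]_N) (x y : 'rV[R]_N) :
  A \in unitmx -> mulmv A x = y <-> x = mulmv (invmx A) y.
Proof.
by move=> Au; split=> [<-|->]; rewrite /mulmv trmxK mulmxA ?mulVmx ?mulmxV//
  mul1mx trmxK.
Qed.

(** * Expectation of real random variables *)

Section expectation.
Context (R : realType) (d : measure_display) (Omega : measurableType d)
  (P : probability Omega R).
Implicit Types X Y : Omega -> R.

Lemma meanE X : mean P X = \int[P]_s X s.
Proof. by rewrite /mean unlock. Qed.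

Lemma finite_mean_cst (a : R) : finite_mean P (fun=> a).
Proof. exact: finite_measure_integrable_cst. Qed.

Lemma finite_meanD X Y : finite_mean P X -> finite_mean P Y ->
  finite_mean P (fun s => X s + Y s).
Proof. by move=> Xf Yf; have := integrableD measurableT Xf Yf. Qed.

Lemma finite_meanZ (a : R) X : finite_mean P X ->
  finite_mean P (fun s => a * X s).
Proof. by move=> Xf; have := integrableZl measurableT a Xf. Qed.

Lemma finite_meanN X : finite_mean P X -> finite_mean P (fun s => - X s).
Proof. by move=> Xf; have := integrableN Xf. Qed.

Lemma finite_meanB X Y : finite_mean P X -> finite_mean P Y ->
  finite_mean P (fun s => X s - Y s).
Proof. by move=> Xf Yf; apply: finite_meanD => //; exact: finite_meanN. Qed.

Lemma finite_mean_sum (I : Type) (r : seq I) (X : I -> Omega -> R) :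
  (forall i, finite_mean P (X i)) ->
  finite_mean P (fun s => \sum_(i <- r) X i s).
Proof.
move=> Xf; elim: r => [|i r IH].
  by under eq_fun do rewrite big_nil; exact: finite_mean_cst.
by under eq_fun do rewrite big_cons; exact: finite_meanD.
Qed.

Lemma mean_cst (a : R) : mean P (fun=> a) = a.
Proof. by rewrite /mean expectation_cst. Qed.

Lemma meanD X Y : finite_mean P X -> finite_mean P Y ->
  mean P (fun s => X s + Y s) = mean P X + mean P Y.
Proof. by move=> Xf Yf; rewrite !meanE RintegralD. Qed.

Lemma meanB X Y : finite_mean P X -> finite_mean P Y ->
  mean P (fun s => X s - Y s) = mean P X - mean P Y.
Proof. by move=> Xf Yf; rewrite !meanE RintegralB. Qed.

Lemma meanZ (a : R) X : finite_mean P X ->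
  mean P (fun s => a * X s) = a * mean P X.
Proof. by move=> Xf; rewrite !meanE RintegralZl. Qed.

Lemma mean_sum (I : Type) (r : seq I) (X : I -> Omega -> R) :
  (forall i, finite_mean P (X i)) ->
  mean P (fun s => \sum_(i <- r) X i s) = \sum_(i <- r) mean P (X i).
Proof.
move=> Xf; elim: r => [|i r IH].
  by rewrite big_nil; under eq_fun do rewrite big_nil; exact: mean_cst.
under eq_fun do rewrite big_cons.
by rewrite big_cons meanD ?IH//; exact: finite_mean_sum.
Qed.

(** The weak inequality is monotonicity of the integral. A zero mean would force [X = 0] almost
    everywhere, impossible for a nowhere vanishing variable on a space of mass 1. *)
Lemma mean_lt0 X : finite_mean P X -> (forall s, X s < 0) -> mean P X < 0.
Proof.
move=> Xf X0; rewrite meanE lt_neqAle; apply/andP; split; last first.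
  have := @le_Rintegral _ _ _ P setT X (fun=> 0) measurableT Xf
    (finite_mean_cst 0).
  by rewrite Rintegral_cst// mul0r; apply=> s _; exact/ltW.
apply/eqP => int0.
(* Since [X] is negative, its absolute value is [- X], whose integral is the opposite of the one
   assumed to be 0. *)
have : (\int[P]_s `|(X s)%:E| = 0)%E.
  under eq_integral do rewrite /= ltr0_norm//.
  rewrite -[LHS]fineK; last exact: integrable_fin_num (finite_meanN Xf).
  congr EFin; rewrite -[LHS]/(\int[P]_s (- X s)).
  rewrite -meanE -(oppr0) -int0 -meanE -mulN1r -meanZ//; congr mean.
  by apply/funext => s; rewrite mulN1r.
move/ae_eq_integral_abs => /(_ measurableT (measurable_int P Xf)) [N [mN PN XN]].
(* The null set [N] contains every point at which [X] is nonzero, hence the whole space. *)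
have : P setT = 0%E.
  apply/eqP; rewrite -measure_le0 -PN le_measure ?inE// => s _; apply: XN => /=.
  by move=> /(_ I) [] /eqP; rewrite lt_eqF.
by rewrite probability_setT => /eqP; rewrite onee_eq0.
Qed.

End expectation.

(** * Directional derivatives, segments and first-order conditions *)

Lemma is_derive_dot (R : realType) (V : normedModType R) (N : nat)
    (f h : V -> 'rV[R]_N) (x v : V) :
  derivable f x v -> derivable h x v ->
  is_derive x v (fun y => dot (f y) (h y))
    (dot ('D_v f x) (h x) + dot (f x) ('D_v h x)).
Proof.
move=> df dh.
have dfk k := (derivable_mxP _ _ _).1 df 0 k.
have dhk k := (derivable_mxP _ _ _).1 dh 0 k.
have -> : (fun y => dot (f y) (h y)) =
    \sum_(k < N) ((fun y => f y 0 k) * (fun y => h y 0 k)).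
  by apply/funext => y; rewrite fct_sumE.
rewrite (derive_mx df) (derive_mx dh).
apply: is_derive_eq.
  apply: is_derive_sum => k; apply: is_deriveM; exact: derivableP.
rewrite -big_split; apply: eq_bigr => k _ /=.
rewrite !mxE addrC; congr (_ + _); exact: mulrC.
Qed.

(** Both difference quotients are the same function of [h], so derivability in the single direction
    [v] suffices. *)
Lemma is_derive_line (R : realType) (V W : normedModType R) (f : V -> W)
    (x v : V) (t : R) :
  derivable f (x + t *: v) v ->
  is_derive t 1 (fun u : R => f (x + u *: v)) ('D_v f (x + t *: v)).
Proof.
move=> df.
have eq_growth : (fun h : R => h^-1 *: (((fun u : R => f (x + u *: v)) \o shift t)
      (h *: 1) - f (x + t *: v))) =
    (fun h : R => h^-1 *: ((f \o shift (x + t *: v)) (h *: v) - f (x + t *: v))).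
  apply/funext => h /=; congr (_ *: (f _ - _)).
  by rewrite [_%:A]mulr1 scalerDl addrCA.
by apply: DeriveDef; rewrite /derivable /derive eq_growth.
Qed.

Lemma convex_segment (R : realType) (V : lmodType R)
    (A : set (convex_lmodType V)) (x y : V) (t : R) :
  convex_set A -> A x -> A y -> 0 <= t <= 1 -> A (x + t *: (y - x)).
Proof.
move=> cA Ax Ay /andP[t0 t1].
(* The convex combination puts weight [t] on its first point, hence [y] before [x]. *)
have := cA y x (Itv01 t0 t1) (mem_set Ay) (mem_set Ax).
rewrite inE; congr A.
rewrite -[LHS]/(t *: y + (1 - t) *: x) scalerBl scale1r scalerBr addrCA.
by [].
Qed.

(** Fermat's rule in the direction [v], reduced to one real variable by restricting [f] to the line
    through [x]. *)
Lemma derive_at_min (R : realType) (V : normedModType R) (A : set V)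
    (f : V -> R) (x v : V) :
  open A -> A x -> (forall y, A y -> derivable f y v) ->
  (forall y, A y -> f x <= f y) -> 'D_v f x = 0.
Proof.
move=> oA Ax df fmin.
(* Openness of [A] provides a radius [e] such that the line stays in [A] for [t] in []- e, e[]. *)
have : \forall t \near (0 : R), A (x + t *: v).
  have : {for (0 : R), continuous (fun t : R => x + t *: v)}.
    apply: cvgD; first exact: cvg_cst.
    exact: cvgZr_tmp.
  by apply; rewrite scale0r addr0; exact: open_nbhs_nbhs.
move=> [e /= e0 eA].
have line (t : R) : t \in `]- e, e[%R -> A (x + t *: v).
  rewrite in_itv /= -ltr_norml => te; apply: eA.
  by rewrite /= sub0r normrN.
have dline (t : R) : t \in `]- e, e[%R ->
    is_derive t 1 (fun t => f (x + t *: v)) ('D_v f (x + t *: v)).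
  by move=> /line At; apply: is_derive_line; exact: df.
have ee0 : 0 \in `]- e, e[%R by rewrite in_itv /= oppr_lt0 e0.
have x0 : x + 0 *: v = x by rewrite scale0r addr0.
have := @derive1_at_min R (fun t => f (x + t *: v)) (- e) e 0
  (ltW (gtrN e0)) (fun t te => @ex_derive _ _ _ _ _ _ _ (dline t te)) ee0.
rewrite x0 => /(_ (fun t te => fmin _ (line t te))) /@derive_val <-.
by have /@derive_val -> := dline _ ee0; rewrite x0.
Qed.

(** Mean value theorem on the segment. The sign is required only at interior points because, in the
    application to a critical point, the derivative vanishes at [t = 0]. *)
Lemma derive_lt0_decr (R : realType) (V : normedModType R) (f : V -> R)
    (x y : V) :
  (forall t : R, 0 <= t <= 1 -> derivable f (x + t *: (y - x)) (y - x)) ->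
  (forall t : R, 0 < t < 1 -> 'D_(y - x) f (x + t *: (y - x)) < 0) ->
  f y < f x.
Proof.
move=> df f0.
pose h (t : R) := f (x + t *: (y - x)).
have dh (t : R) : t \in `[0, 1]%R -> is_derive t 1 h ('D_(y - x) f (x + t *: (y - x))).
  by rewrite in_itv /= => t01; apply: is_derive_line; exact: df.
have hc : {within `[0, 1], continuous h}.
  by apply: derivable_within_continuous => t /dh.
have [t t01] := MVT ltr01 (fun t t01 => dh t (subset_itv_oo_cc t01)) hc.
rewrite /h scale1r scale0r addr0 subrKC subr0 mulr1 -subr_lt0 => ->.
by apply: f0; move: t01; rewrite in_itv.
Qed.

(** Along the segment, the derivative of [dot (y - x) (g z)] in the direction [y - x] is the
    quadratic form of the Jacobian at [y - x], which is negative. *)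
Lemma negative_jacobian_monotone (R : realType) (N : nat) (A : set 'rV[R]_N)
    (g : 'rV[R]_N -> 'rV[R]_N) (x y : 'rV[R]_N) :
  convex_set A ->
  (forall z, A z -> differentiable g z /\ negative_definite (jacobian g z)) ->
  A x -> A y -> x != y -> dot (y - x) (g y) < dot (y - x) (g x).
Proof.
move=> cA dg Ax Ay xy.
have dgv z : A z -> is_derive z (y - x) (fun z => dot (y - x) (g z))
    (dot (y - x) (mulmv (jacobian g z) (y - x))).
  move=> /dg[dgz _].
  have := is_derive_dot (derivable_cst (y - x) z (y - x))
    (diff_derivable (v := y - x) dgz).
  by rewrite derive_cst deriveEjacobian// (dotC 0) dot0r add0r dot_mulmv dotC.
apply: (derive_lt0_decr (f := fun z => dot (y - x) (g z))) => t t01.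
  by have /dgv := convex_segment cA Ax Ay t01.
have Az : A (x + t *: (y - x)).
  by apply: convex_segment => //; case/andP: t01 => /ltW-> /ltW->.
have -> := @derive_val _ _ _ _ _ _ _ (dgv _ Az).
by apply: (dg _ Az).2; rewrite subr_eq0 eq_sym.
Qed.

(* On the segment from x to y, the derivative of W at z = x + t (y - x) is
   dot (y - x) (g z), whose sign is that of dot (z - x) (g z - g x). *)
Lemma critical_point_strict_max (R : realType) (N : nat) (A : set 'rV[R]_N)
    (W : 'rV[R]_N -> R) (g : 'rV[R]_N -> 'rV[R]_N) (x y : 'rV[R]_N) :
  convex_set A ->
  (forall z, A z -> differentiable g z /\ negative_definite (jacobian g z)) ->
  (forall z v, A z -> is_derive z v W (dot v (g z))) ->
  A x -> A y -> x != y -> g x = 0 -> W y < W x.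
Proof.
move=> cA dg dW Ax Ay xy gx0.
apply: derive_lt0_decr => t t01.
  by have /(dW _ (y - x)) := convex_segment cA Ax Ay t01.
have Az : A (x + t *: (y - x)).
  by apply: convex_segment => //; case/andP: t01 => /ltW-> /ltW->.
have -> := @derive_val _ _ _ _ _ _ _ (dW _ (y - x) Az).
case/andP: t01 => t0 _.
have := negative_jacobian_monotone cA dg Ax Az.
rewrite gx0 dot0r (addrC x) addrK dotZl pmulr_rlt0//; apply.
rewrite eq_sym -subr_eq0 addrK scaler_eq0 negb_or (gt_eqF t0)/=.
by rewrite subr_eq0 eq_sym.
Qed.

(** The subgradient inequality says that [U y + dot y m] is minimal over [A] at [y = x], so Fermat's
    rule applies to this sum. *)
Lemma derive_subgradient (R : realType) (N : nat) (A : set 'rV[R]_N)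
    (U : 'rV[R]_N -> R) (m : 'rV[R]_N) (x v : 'rV[R]_N) :
  open A -> A x -> (forall y, A y -> derivable U y v) ->
  (forall y, A y -> U x - dot (y - x) m <= U y) -> 'D_v U x = - dot v m.
Proof.
move=> oA Ax dU sub.
have dm y : is_derive y v (fun z => dot z m) (dot v m).
  have := is_derive_dot (@derivable_id _ _ y v) (derivable_cst m y v).
  by rewrite derive_id derive_cst dot0r addr0.
have dUm y : A y -> is_derive y v (U + (fun z => dot z m)) ('D_v U y + dot v m).
  by move=> Ay; apply: is_deriveD; apply: derivableP; exact: dU.
apply/eqP; rewrite -subr_eq0 opprK -(@derive_val _ _ _ _ _ _ _ (dUm _ Ax)).
apply/eqP/(derive_at_min oA Ax) => y Ay; first by have := dUm _ Ay.
by rewrite /= -[leRHS]/(U y + dot y m) -lerBlDr -addrA -opprB -dotBl sub.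
Qed.

(** * Expectation of random vectors and matrices *)

Section vector_expectation.
Context (R : realType) (d : measure_display) (Omega : measurableType d)
  (P : probability Omega R) (N : nat).

Lemma finite_mean_dot (v : 'rV[R]_N) (X : Omega -> 'rV[R]_N) :
  finite_mean_mx P X -> finite_mean P (fun s => dot v (X s)).
Proof. by move=> Xf; apply: finite_mean_sum => k; exact: finite_meanZ. Qed.

Lemma mean_dot (v : 'rV[R]_N) (X : Omega -> 'rV[R]_N) :
  finite_mean_mx P X -> mean P (fun s => dot v (X s)) = dot v (mean_mx P X).
Proof.
move=> Xf; rewrite mean_sum; last by move=> k; exact: finite_meanZ.
by apply: eq_bigr => k _; rewrite meanZ// mxE.
Qed.

Lemma finite_mean_mxB (X Y : Omega -> 'rV[R]_N) :
  finite_mean_mx P X -> finite_mean_mx P Y ->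
  finite_mean_mx P (fun s => X s - Y s).
Proof.
move=> Xf Yf i j; under eq_fun do rewrite mxE [X in _ + X]mxE.
exact: finite_meanB.
Qed.

Lemma mean_mxB (X Y : Omega -> 'rV[R]_N) :
  finite_mean_mx P X -> finite_mean_mx P Y ->
  mean_mx P (fun s => X s - Y s) = mean_mx P X - mean_mx P Y.
Proof.
move=> Xf Yf; apply/matrixP => i j; rewrite !mxE.
under eq_fun do rewrite mxE [X in _ + X]mxE.
exact: meanB.
Qed.

Lemma finite_mean_mx_sum (I : Type) (r : seq I) (X : I -> Omega -> 'rV[R]_N) :
  (forall i, finite_mean_mx P (X i)) ->
  finite_mean_mx P (fun s => \sum_(i <- r) X i s).
Proof.
move=> Xf i j; under eq_fun do rewrite summxE.
by apply: finite_mean_sum => k; exact: Xf.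
Qed.

Lemma mean_mx_sum (I : Type) (r : seq I) (X : I -> Omega -> 'rV[R]_N) :
  (forall i, finite_mean_mx P (X i)) ->
  mean_mx P (fun s => \sum_(i <- r) X i s) = \sum_(i <- r) mean_mx P (X i).
Proof.
move=> Xf; apply/matrixP => i j; rewrite summxE mxE.
under eq_fun do rewrite summxE.
by rewrite mean_sum => [|k]; [apply: eq_bigr => k _; rewrite mxE|exact: Xf].
Qed.

(** Puts the fixed vector on the left of a dot product, the shape to which [finite_mean_dot] and
    [mean_dot] apply. *)
Lemma mulmv_coord (A : 'M[R]_N) (x : 'rV[R]_N) (i : 'I_1) (k : 'I_N) :
  mulmv A x i k = dot x (row k A).
Proof.
by rewrite (ord1 i) 2!mxE; apply: eq_bigr => t _; rewrite !mxE mulrC.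
Qed.

Lemma finite_mean_row (G : Omega -> 'M[R]_N) (k : 'I_N) :
  finite_mean_mx P G -> finite_mean_mx P (fun s => row k (G s)).
Proof. by move=> Gf i j; under eq_fun do rewrite mxE; exact: Gf. Qed.

Lemma finite_mean_mulmv (G : Omega -> 'M[R]_N) (x : 'rV[R]_N) :
  finite_mean_mx P G -> finite_mean_mx P (fun s => mulmv (G s) x).
Proof.
move=> Gf i k; under eq_fun do rewrite mulmv_coord.
by apply: finite_mean_dot; exact: finite_mean_row.
Qed.

Lemma mean_mulmv (G : Omega -> 'M[R]_N) (x : 'rV[R]_N) :
  finite_mean_mx P G ->
  mean_mx P (fun s => mulmv (G s) x) = mulmv (mean_mx P G) x.
Proof.
move=> Gf; apply/matrixP => i k; rewrite mxE mulmv_coord.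
under eq_fun do rewrite mulmv_coord.
rewrite mean_dot; last exact: finite_mean_row.
by congr dot; apply/rowP => t; rewrite !mxE; congr mean; apply/funext => s;
  rewrite mxE.
Qed.

(** The quadratic form of the mean matrix at [x] is the mean of the quadratic forms, each of them
    strictly negative. *)
Lemma negative_definite_mean (G : Omega -> 'M[R]_N) :
  finite_mean_mx P G -> (forall s, negative_definite (G s)) ->
  negative_definite (mean_mx P G).
Proof.
move=> Gf Gneg x x0; rewrite -mean_mulmv// -mean_dot; last first.
  exact: finite_mean_mulmv.
apply: mean_lt0 => [|s]; last exact: Gneg.
by apply: finite_mean_dot; exact: finite_mean_mulmv.
Qed.

End vector_expectation.

(** * The critical price equation, and derivatives of demand, [phi] and indirect surplus *)

(** Splitting [pi - lambda] as [(pi - c) - (lambda - c)] gives [g pi = E[G] (pi - c) -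
    E[G (lambda - c)]], which is solved for [pi]. The centre [c] is arbitrary; the stated formula
    takes the mean of [lambda]. *)
Lemma g_eq0 (R : realType) (d : measure_display) (Omega : measurableType d)
    (P : probability Omega R) (N M : nat) (lambda : Omega -> 'rV[R]_N)
    (omega : 'I_M -> Omega -> 'rV[R]_N)
    (D : 'I_M -> 'rV[R]_N -> 'rV[R]_N -> 'rV[R]_N) (pi c : 'rV[R]_N) :
  let G := grad_demand omega D pi in
  finite_mean_mx P G ->
  finite_mean_mx P (fun s => mulmv (G s) (lambda s)) ->
  mean_mx P G \in unitmx ->
  g P lambda omega D pi = 0 <->
  pi = c + mulmv (invmx (mean_mx P G))
             (mean_mx P (fun s => mulmv (G s) (lambda s - c))).
Proof.
move=> G Gf Gl Gu.
have -> : g P lambda omega D pi = mulmv (mean_mx P G) (pi - c) -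
    mean_mx P (fun s => mulmv (G s) (lambda s - c)).
  rewrite -mean_mulmv// -mean_mxB; last 2 first.
  - exact: finite_mean_mulmv.
  - under eq_fun do rewrite mulmvB.
    by apply: finite_mean_mxB => //; exact: finite_mean_mulmv.
  rewrite /g; congr mean_mx; apply/funext => s.
  by rewrite -mulmvB opprB addrA subrK.
split=> [/eqP|E].
  by rewrite subr_eq0 => /eqP/(mulmv_eq _ _ Gu) <-; rewrite subrKC.
apply/eqP; rewrite subr_eq0; apply/eqP/(mulmv_eq _ _ Gu).
by rewrite {1}E addrC addKr.
Qed.

Lemma differentiable_total_demand (R : realType) (d : measure_display)
    (Omega : measurableType d) (N M : nat) (omega : 'I_M -> Omega -> 'rV[R]_N)
    (D : 'I_M -> 'rV[R]_N -> 'rV[R]_N -> 'rV[R]_N) (pi : 'rV[R]_N) (s : Omega) :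
  (forall i, differentiable (fun p => D i p (omega i s)) pi) ->
  differentiable (fun p => total_demand omega D p s) pi.
Proof.
move=> Ddf; rewrite (_ : (fun _ => _) = \sum_(i < M) (fun p => D i p (omega i s))).
  exact: differentiable_sum.
by apply/funext => p; rewrite fct_sumE.
Qed.

Lemma negative_definite_grad_demand (R : realType) (d : measure_display)
    (Omega : measurableType d) (N M : nat) (omega : 'I_M -> Omega -> 'rV[R]_N)
    (D : 'I_M -> 'rV[R]_N -> 'rV[R]_N -> 'rV[R]_N) (pi : 'rV[R]_N) (s : Omega) :
  (0 < M)%N ->
  (forall i, differentiable (fun p => D i p (omega i s)) pi) ->
  (forall i, negative_definite (jacobian (fun p => D i p (omega i s)) pi)) ->
  negative_definite (grad_demand omega D pi s).
Proof.
move=> M0 Ddf Dneg x x0.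
rewrite dot_mulmv /grad_demand -deriveEjacobian; last first.
  exact: differentiable_total_demand.
rewrite (_ : (fun _ => _) = \sum_(i < M) (fun p => D i p (omega i s))); last first.
  by apply/funext => p; rewrite fct_sumE.
rewrite derive_sum => [|i]; last exact: diff_derivable.
(* Customer 0, who exists since [M] is positive, is singled out to make the sum of negative terms
   strictly negative. *)
rewrite dotC dot_sumr (bigD1 (Ordinal M0))//= ltr_wnDr//.
  apply: sumr_le0 => i _.
  by rewrite deriveEjacobian// dotC -dot_mulmv ltW// Dneg.
by rewrite deriveEjacobian// dotC -dot_mulmv Dneg.
Qed.

(** Product rule under the expectation: differentiating the margin [p - lambda] gives the mean
    demand, and differentiating demand gives [g] after moving the Jacobian to the other side of the
    dot product. *)
Lemma is_derive_phi (R : realType) (d : measure_display)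
    (Omega : measurableType d) (P : probability Omega R) (N M : nat)
    (lambda : Omega -> 'rV[R]_N) (omega : 'I_M -> Omega -> 'rV[R]_N)
    (D : 'I_M -> 'rV[R]_N -> 'rV[R]_N -> 'rV[R]_N) (pi v : 'rV[R]_N) :
  (forall i s, differentiable (fun p => D i p (omega i s)) pi) ->
  finite_mean_mx P (total_demand omega D pi) ->
  finite_mean_mx P (grad_demand omega D pi) ->
  finite_mean_mx P (fun s => mulmv (grad_demand omega D pi s) (lambda s)) ->
  derivative_exchanges_with_mean P
    (fun p s => dot (p - lambda s) (total_demand omega D p s)) pi ->
  is_derive pi v (phi P lambda omega D)
    (dot v (mean_mx P (total_demand omega D pi)) + dot v (g P lambda omega D pi)).
Proof.
move=> Ddf Df Gf Glf /(_ v)[dphi _ Dphi]; apply: DeriveDef => //.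
rewrite [LHS]Dphi.
have gf : finite_mean_mx P
    (fun s => mulmv (grad_demand omega D pi s) (pi - lambda s)).
  under eq_fun do rewrite mulmvB.
  by apply: finite_mean_mxB => //; exact: finite_mean_mulmv.
rewrite /g -!mean_dot// -meanD//; try exact: finite_mean_dot.
congr mean; apply/funext => s.
have dTD : differentiable (fun p => total_demand omega D p s) pi.
  exact: differentiable_total_demand.
have dprice : is_derive pi v (fun p : 'rV[R]_N => p - lambda s) v.
  by rewrite -[X in is_derive _ _ _ X]subr0; exact: is_deriveB.
have := is_derive_dot (@ex_derive _ _ _ _ _ _ _ dprice) (diff_derivable (v := v) dTD).
rewrite (@derive_val _ _ _ _ _ _ _ dprice) deriveEjacobian// => /@derive_val ->.
by rewrite dot_mulmv [X in _ + X]dotC.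
Qed.

(* The demand at price p' remains a feasible policy at price p, so the indirect
   surplus has the subgradient - E[demand] at every price. *)
Lemma is_derive_indirect_surplus (R : realType) (d : measure_display)
    (Omega : measurableType d) (P : probability Omega R) (N : nat)
    (om : Omega -> 'rV[R]_N) (S : 'rV[R]_N -> 'rV[R]_N -> R)
    (D : 'rV[R]_N -> 'rV[R]_N -> 'rV[R]_N) (Prices : set 'rV[R]_N) :
  let U p := mean P (fun s => S (D p (om s)) (om s) - dot p (D p (om s))) in
  open Prices ->
  (forall p, Prices p -> optimal_policy P S om (two_part 0 p) (D p)) ->
  (forall p, Prices p -> finite_mean P (fun s => S (D p (om s)) (om s))) ->
  (forall p, Prices p -> finite_mean_mx P (fun s => D p (om s))) ->
  (forall p v, Prices p -> derivable U p v) ->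
  forall p v, Prices p ->
  is_derive p v U (- dot v (mean_mx P (fun s => D p (om s)))).
Proof.
move=> U oP opt Sf Df dU p v Pp; apply: DeriveDef; first exact: dU.
apply: (derive_subgradient oP Pp) => [y Py|p' Pp']; first exact: dU.
have netE a b : (fun s => net_surplus S (two_part 0 a) (D b) (om s)) =
    (fun s => S (D b (om s)) (om s) - dot a (D b (om s))).
  by apply/funext => s; rewrite /net_surplus /two_part add0r.
have [causal _ _] := opt p Pp.
have [_ _ /(_ _ causal)] := opt p' Pp'.
rewrite !netE.
have dotf a b : Prices b -> finite_mean P (fun s => dot a (D b (om s))).
  by move=> Pb; exact/finite_mean_dot/Df.
rewrite -/(U p') => /(_ (finite_meanB (Sf _ Pp) (dotf _ _ Pp))).
apply: le_trans.
rewrite /U !(meanB (Sf _ Pp) (dotf _ _ Pp)) !(mean_dot _ (Df _ Pp)).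
by rewrite dotBl opprB addrA subrK.
Qed.

(** * Retailer and consumer surplus under two-part tariffs, and elimination of the fixed charge *)

Section surplus.
Context (R : realType) (d : measure_display) (Omega : measurableType d)
  (P : probability Omega R) (N M : nat) (lambda : Omega -> 'rV[R]_N)
  (omega : 'I_M -> Omega -> 'rV[R]_N) (S : 'I_M -> 'rV[R]_N -> 'rV[R]_N -> R)
  (q : 'I_M -> ('rV[R]_N -> R) -> 'rV[R]_N -> 'rV[R]_N)
  (D : 'I_M -> 'rV[R]_N -> 'rV[R]_N -> 'rV[R]_N).

Lemma rs_two_part (A : R) (pi : 'rV[R]_N) :
  (forall i w, q i (two_part A pi) w = D i pi w) ->
  finite_mean_mx P (total_demand omega D pi) ->
  finite_mean P (fun s => dot (lambda s) (total_demand omega D pi s)) ->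
  rs P lambda omega q (two_part A pi) = phi P lambda omega D pi + M%:R * A.
Proof.
move=> qD Df lDf; rewrite /rs /phi -[M%:R * A](mean_cst P) -meanD; last 2 first.
- under eq_fun do rewrite dotBl.
  by apply: finite_meanB => //; exact: finite_mean_dot.
- exact: finite_mean_cst.
congr mean; apply/funext => s; rewrite /total_demand dot_sumr addrC.
(* The term [M%:R * A] becomes a sum of [A] over the customers, to be matched term by term. *)
rewrite -[M in M%:R]card_ord mulr_natl -sumr_const -big_split /=.
by apply: eq_bigr => i _; rewrite qD dotBl /two_part addrA.
Qed.

Lemma cs_two_part (A : R) (pi : 'rV[R]_N) :
  (forall i w, q i (two_part A pi) w = D i pi w) ->
  (forall i, finite_mean P (fun s => S i (D i pi (omega i s)) (omega i s))) ->
  (forall i, finite_mean_mx P (fun s => D i pi (omega i s))) ->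
  cs P omega S q (two_part A pi) =
  \sum_(i < M) mean P (fun s => S i (D i pi (omega i s)) (omega i s)
                                - dot pi (D i pi (omega i s))) - M%:R * A.
Proof.
move=> qD Sf Df.
have Uf i : finite_mean P (fun s => S i (D i pi (omega i s)) (omega i s)
                                - dot pi (D i pi (omega i s))).
  by apply: finite_meanB => //; exact: finite_mean_dot.
rewrite /cs -mean_sum// -[M%:R * A](mean_cst P) -meanB; last 2 first.
- exact: finite_mean_sum.
- exact: finite_mean_cst.
congr mean; apply/funext => s.
rewrite -[M in M%:R]card_ord mulr_natl -sumr_const -sumrB.
by apply: eq_bigr => i _; rewrite !qD /two_part opprD addrA addrAC.
Qed.

(* The budget constraint determines A, which turns the regulator's problem into
   the unconstrained maximization of total surplus over prices. *)
Lemma regulator_solutionE (Prices : set 'rV[R]_N) (U f : 'rV[R]_N -> R)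
    (F A : R) (pi : 'rV[R]_N) :
  (0 < M)%N ->
  (forall A pi, Prices pi ->
     rs P lambda omega q (two_part A pi) = f pi + M%:R * A) ->
  (forall A pi, Prices pi ->
     cs P omega S q (two_part A pi) = U pi - M%:R * A) ->
  Prices pi ->
  regulator_solution P lambda omega S q Prices F A pi <->
  (forall p, Prices p -> U p + f p <= U pi + f pi) /\
  A = M%:R^-1 * (F - f pi).
Proof.
move=> M0 rsE csE Ppi.
have M_neq0 : M%:R != 0 :> R by rewrite pnatr_eq0 -lt0n.
have budget B p : Prices p -> rs P lambda omega q (two_part B p) = F <->
    B = M%:R^-1 * (F - f p).
  by move=> Pp; rewrite rsE//; split=> [<-|->]; [rewrite addrC addKr mulKf|
    rewrite mulVKf// subrKC].
have csF B p : Prices p -> rs P lambda omega q (two_part B p) = F ->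
    cs P omega S q (two_part B p) = U p + f p - F.
  by move=> Pp; rewrite csE// rsE// => <-; rewrite opprD addrA addrK.
split=> [[_ rsF opt]|[opt /(budget _ _ Ppi) rsF]].
  split; last exact/budget.
  (* Every price [p] in [Prices] becomes feasible once paired with the fixed charge that the budget
     dictates. *)
  move=> p Pp; have /(budget _ _ Pp) rsp := erefl (M%:R^-1 * (F - f p)).
  by have := opt _ _ Pp rsp; rewrite !csF// lerD2r.
by split=> // B p Pp rsp; rewrite !csF// lerD2r opt.
Qed.

End surplus.

Theorem theorem1 (R : realType) (d : measure_display)
    (Omega : measurableType d) (P : probability Omega R) (N M : nat)
    (N_ge1 : (1 <= N)%N) (M_ge1 : (1 <= M)%N)
    (* wholesale prices and local states *)
    (lambda : Omega -> 'rV[R]_N) (omega : 'I_M -> Omega -> 'rV[R]_N)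
    (lambda_rv : random_vector lambda)
    (lambda_ge0 : forall s, nonnegative_vec (lambda s))
    (omega_rv : forall i, random_vector (omega i))
    (* gross surplus functions *)
    (S : 'I_M -> 'rV[R]_N -> 'rV[R]_N -> R)
    (S_C1 : forall i, continuously_differentiable_on setT
       (fun z : 'rV[R]_N * 'rV[R]_N => S i z.1 z.2))
    (* prices on which demand is defined; setT is the unrestricted case *)
    (Prices : set 'rV[R]_N)
    (Prices_open : open Prices) (Prices_convex : convex_set Prices)
    (* consumption, and demand under affine tariffs *)
    (q : 'I_M -> ('rV[R]_N -> R) -> 'rV[R]_N -> 'rV[R]_N)
    (q_optimal : forall i A pi, Prices pi ->
       optimal_policy P (S i) (omega i) (two_part A pi) (q i (two_part A pi)))
    (D : 'I_M -> 'rV[R]_N -> 'rV[R]_N -> 'rV[R]_N)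
    (qD : forall i A pi w, Prices pi -> q i (two_part A pi) w = D i pi w)
    (D_ge0 : forall i pi w, Prices pi -> nonnegative_vec (D i pi w))
    (D_C1 : forall i w,
       continuously_differentiable_on Prices (fun p => D i p w))
    (D_negdef : forall i pi w, Prices pi ->
       negative_definite (jacobian (fun p => D i p w) pi))
    (* finite expectations *)
    (lambda_fin : finite_mean_mx P lambda)
    (S_fin : forall i pi, Prices pi ->
       finite_mean P (fun s => S i (D i pi (omega i s)) (omega i s)))
    (D_fin : forall i pi, Prices pi ->
       finite_mean_mx P (fun s => D i pi (omega i s)))
    (lambdaD_fin : forall pi, Prices pi ->
       finite_mean P (fun s => dot (lambda s) (total_demand omega D pi s)))
    (gradD_fin : forall pi, Prices pi ->
       finite_mean_mx P (grad_demand omega D pi))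
    (gradDlambda_fin : forall pi, Prices pi ->
       finite_mean_mx P (fun s => mulmv (grad_demand omega D pi s) (lambda s)))
    (* exchange of differentiation and expectation *)
    (exchange_cs : forall i pi, Prices pi ->
       derivative_exchanges_with_mean P
         (fun p s => S i (D i p (omega i s)) (omega i s)
                     - dot p (D i p (omega i s))) pi)
    (exchange_phi : forall pi, Prices pi ->
       derivative_exchanges_with_mean P
         (fun p s => dot (p - lambda s) (total_demand omega D p s)) pi)
    (* the standing assumption on g *)
    (g_negdef : forall pi, Prices pi ->
       differentiable (g P lambda omega D) pi /\
       negative_definite (jacobian (g P lambda omega D) pi))
    (F : R) :
  let gradD_mean := fun pi => mean_mx P (grad_demand omega D pi) in
  let lambda_mean := mean_mx P lambda in
  let solves := regulator_solution P lambda omega S q Prices F in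
  [/\ forall pi, Prices pi -> gradD_mean pi \in unitmx,
      forall (A : R) (pi : 'rV[R]_N), Prices pi ->
        (solves A pi <->
           pi = lambda_mean
                + mulmv (invmx (gradD_mean pi))
                    (mean_mx P (fun s =>
                       mulmv (grad_demand omega D pi s)
                             (lambda s - lambda_mean)))
           /\ A = M%:R^-1 * (F - phi P lambda omega D pi)) &
      forall (A A' : R) (pi pi' : 'rV[R]_N),
        solves A pi -> solves A' pi' -> A = A' /\ pi = pi'].
Proof.
move=> gradD_mean lambda_mean solves.
have Ddf i s pi : Prices pi -> differentiable (fun p => D i p (omega i s)) pi.
  by move=> /(D_C1 i (omega i s))[].
have TDf pi : Prices pi -> finite_mean_mx P (total_demand omega D pi).
  by move=> Ppi; apply: finite_mean_mx_sum => i; exact: D_fin.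
have unit_gradD pi : Prices pi -> gradD_mean pi \in unitmx.
  move=> Ppi; apply: negative_definite_unitmx.
  apply: negative_definite_mean => [|s]; first exact: gradD_fin.
  by apply: negative_definite_grad_demand => // i; [exact: Ddf|exact: D_negdef].
pose U i p := mean P (fun s => S i (D i p (omega i s)) (omega i s)
                               - dot p (D i p (omega i s))).
pose W p := \sum_(i < M) U i p + phi P lambda omega D p.
have dU i p v : Prices p ->
    is_derive p v (U i) (- dot v (mean_mx P (fun s => D i p (omega i s)))).
  apply: is_derive_indirect_surplus => //.
  (* Optimality is assumed for consumption under a tariff; demand inherits it as the consumption
     under the tariff with zero fixed charge. *)
  - move=> {}p Pp; rewrite (_ : D i p = q i (two_part 0 p)); first exact: q_optimal.
    by apply/funext => w; rewrite qD.
  - exact: S_fin.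
  - exact: D_fin.
  - by move=> {}p {}v Pp; have [] := exchange_cs i p Pp v.
have dW p v : Prices p -> is_derive p v W (dot v (g P lambda omega D p)).
  move=> Pp.
  have -> : W = \sum_(i < M) U i + phi P lambda omega D.
    by apply/funext => y; rewrite fct_sumE.
  have dphi := is_derive_phi v (fun i s => Ddf i s p Pp) (TDf p Pp)
    (gradD_fin p Pp) (gradDlambda_fin p Pp) (exchange_phi p Pp).
  apply: is_derive_eq.
    by apply: is_deriveD; apply: is_derive_sum => i; exact: dU.
  (* The envelope terms add up to minus the mean total demand, cancelling the first term in the
     derivative of [phi]. *)
  rewrite sumrN -dot_sumr -mean_mx_sum => [|i]; last exact: D_fin.
  by rewrite addKr.
have solvesE A pi : Prices pi -> solves A pi <->
    (forall p, Prices p -> W p <= W pi) /\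
    A = M%:R^-1 * (F - phi P lambda omega D pi).
  apply: regulator_solutionE => // [B p Pp|B p Pp].
  - by apply: rs_two_part => [i w||]; [exact: qD|exact: TDf|exact: lambdaD_fin].
  - by apply: cs_two_part => [i w|i|i]; [exact: qD|exact: S_fin|exact: D_fin].
have maxE pi : Prices pi ->
    (forall p, Prices p -> W p <= W pi) <-> g P lambda omega D pi = 0.
  move=> Ppi; split=> [Wmax|g0 p Pp].
    apply: dot_eq0 => v; rewrite -(@derive_val _ _ _ _ _ _ _ (dW pi v Ppi)).
    (* Fermat's rule is available for minima, so it is applied to [- W]. *)
    apply/eqP; rewrite -oppr_eq0 -deriveN; last by have := dW pi v Ppi.
    apply/eqP/(derive_at_min Prices_open Ppi) => p Pp.
      by have := dW p v Pp => dWp; exact: derivableN.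
    by rewrite lerN2 Wmax.
  (* The strict comparison concerns distinct prices, so [p = pi] is treated apart. *)
  have [->//|pip] := eqVneq pi p.
  exact: ltW (critical_point_strict_max Prices_convex g_negdef dW Ppi Pp pip g0).
split=> // [A pi Ppi|A A' pi pi' sol sol'].
  rewrite solvesE// maxE// (g_eq0 lambda_mean)//.
  - exact: gradD_fin.
  - exact: gradDlambda_fin.
  - exact: unit_gradD.
have [Ppi _ _] := sol; have [Ppi' _ _] := sol'.
move: sol sol' => /(solvesE _ _ Ppi)[Wmax ->] /(solvesE _ _ Ppi')[Wmax' ->].
(* Both charges are now the same function of the price, so only equality of prices remains. If they
   differed, the critical point [pi] would strictly beat [pi'], which is itself a maximizer. *)
suff -> : pi = pi' by [].
apply: contrapT => /eqP pipi'.
have /(maxE _ Ppi) g0 := Wmax.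
have := critical_point_strict_max Prices_convex g_negdef dW Ppi Ppi' pipi' g0.
by rewrite ltNge Wmax'.
Qed.
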